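(* Consider the random field Ising model with Gaussian field in dimension $d\ge1$. There is a constant $C_5\in(0,\infty)$, depending only on $d$, such that for every $0\le\beta<\infty$ there exists $H_3(\beta)>0$ such that for each $H>H_3(\beta)$ and for almost all realizations $\vec h\in\mathbb{R}^{\mathbb{Z}^d}$ of $\vec H$ the following holds: for all finite subsets $\Delta\subseteq\Lambda$ of $\mathbb{Z}^d$, $$\sup_{\eta,\eta'\in\{-1,+1\}^{\partial_{ex}\Lambda}}TV\left(P^{\vec h}_{\Lambda,\eta,\beta,H}(\sigma_\Delta\in\cdot),P^{\vec h}_{\Lambda,\eta',\beta,H}(\sigma_\Delta\in\cdot)\right)\le\sum_{x\in\partial_{ex}\Delta,\,y\in\partial_{ex}\Lambda}C_6(x,\vec h)\,e^{-C_5|x-y|},$$ where $C_6(x,\vec h)\in(0,\infty)$ depends only on $x$ and $\vec h$ (and $d$).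
   Context: For a finite $\Lambda\subseteq\mathbb{Z}^d$, $\partial_{ex}\Lambda$ is the set of vertices of $\mathbb{Z}^d\setminus\Lambda$ having a nearest neighbor in $\Lambda$. For $\beta\ge0$, $H\ge 0$, $\eta\in\{-1,+1\}^{\partial_{ex}\Lambda}$ and $\vec h\in\mathbb{R}^\Lambda$, $P^{\vec h}_{\Lambda,\eta,\beta,H}$ is the probability measure on $\{-1,+1\}^\Lambda$ given by $$P^{\vec h}_{\Lambda,\eta,\beta,H}(\sigma)\propto\exp\Big[\beta\sum_{\{u,v\}}\sigma_u\sigma_v+\beta\sum_{\{u,v\}:u\in\Lambda,v\in\partial_{ex}\Lambda}\sigma_u\eta_v+H\sum_{u\in\Lambda}h_u\sigma_u\Big],$$ where the first sum is over (unordered) nearest neighbor pairs in $\Lambda$ and the second over nearest neighbor pairs; for $\vec h\in\mathbb{R}^{\mathbb{Z}^d}$ the restriction of $\vec h$ to $\Lambda$ is used. In the RFIM with Gaussian field, $\vec h$ is a realization of $\vec H=(H_u)_{u\in\mathbb{Z}^d}$ with $H_u$ i.i.d. $N(0,1)$. $\sigma_\Delta$ is the restriction of $\sigma$ to $\Delta$, $TV$ is total variation distance, $|\cdot|$ is the Euclidean norm. *)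

(* Defs.v *)
From HB Require Import structures.
From mathcomp Require Import all_boot all_order all_algebra.
From mathcomp Require Import finmap.
From mathcomp Require Import all_classical all_reals all_analysis.

Set Implicit Arguments.
Unset Strict Implicit.
Unset Printing Implicit Defensive.

Import Order.TTheory GRing.Theory Num.Theory.
Import numFieldNormedType.Exports.

Local Open Scope classical_set_scope.
Local Open Scope ring_scope.

Definition site (d : nat) := 'rV[int]_d.

Definition neighbors (d : nat) (u : site d) : {fset site d} :=
  ([fset (u + delta_mx 0 i)%R | i : 'I_d]
   `|` [fset (u - delta_mx 0 i)%R | i : 'I_d])%fset.

Definition adj (d : nat) (u v : site d) : bool := v \in neighbors u.

Definition ext_boundary (d : nat) (L : {fset site d}) : {fset site d} :=
  ((\bigcup_(u <- L) neighbors u) `\` L)%fset.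

Lemma adjE (d : nat) (u v : site d) :
  adj u v = [exists i, (v == u + delta_mx 0 i) || (v == u - delta_mx 0 i)].
Proof.
rewrite /adj /neighbors inE; apply/orP/existsP.
  by case=> /imfsetP[i _ ->]; exists i; rewrite eqxx ?orbT.
by case=> i /orP[] /eqP ->; [left | right]; apply/imfsetP; exists i.
Qed.

Lemma ext_boundaryP (d : nat) (L : {fset site d}) (v : site d) :
  reflect (v \notin L /\ exists2 u, u \in L & adj u v) (v \in ext_boundary L).
Proof.
rewrite /ext_boundary inE; apply: (iffP andP) => -[vL].
  by move=> /bigfcupP[u /andP[uL _] uv]; split=> //; exists u.
by move=> [u uL uv]; split=> //; apply/bigfcupP; exists u; rewrite ?uL.
Qed.

Definition euclid_norm (R : realType) (d : nat) (u : site d) : R :=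
  Num.sqrt (\sum_(i < d) ((u 0 i)%:~R : R) ^+ 2).

(* Elements of {-1,+1}^A; [true] encodes +1 and [false] encodes -1. *)
Definition config (d : nat) (A : {fset site d}) := {ffun A -> bool}.

Definition spin (R : realType) (b : bool) : R := if b then 1 else -1.

Definition restrict (d : nat) (D L : {fset site d}) (DL : (D `<=` L)%fset)
    (s : config L) : config D :=
  [ffun u => s (fincl DL u)].

Section Gibbs.
Variables (R : realType) (d : nat) (L : {fset site d}).
Variables (eta : config (ext_boundary L)) (beta H : R) (h : site d -> R).

(* In the first sum every unordered pair {u, v} occurs twice, hence the 1/2. *)
Definition exponent (s : config L) : R :=
  beta * (2^-1 * \sum_(u : L) \sum_(v : L | adj (val u) (val v))
            spin R (s u) * spin R (s v))
  + beta * (\sum_(u : L) \sum_(v : ext_boundary L | adj (val u) (val v))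
            spin R (s u) * spin R (eta v))
  + H * (\sum_(u : L) h (val u) * spin R (s u)).

Definition gibbs (s : config L) : R :=
  expR (exponent s) / \sum_(t : config L) expR (exponent t).

Definition gibbs_marginal (D : {fset site d}) (DL : (D `<=` L)%fset)
    (A : {set config D}) : R :=
  \sum_(s : config L | restrict DL s \in A) gibbs s.

End Gibbs.

(* Total variation distance of two laws on a finite type, given as functions of
   the event; 0 is a neutral default since the maximized terms are >= 0. *)
Definition TV (R : realType) (T : finType) (mu nu : {set T} -> R) : R :=
  \big[Num.max/0]_(A : {set T}) `|mu A - nu A|.

Definition mutually_independent (disp : measure_display)
    (T : measurableType disp) (R : realType) (P : probability T R)
    (I : choiceType) (X : I -> {RV P >-> R}) : Prop :=
  forall (J : {fset I}) (A : I -> set R), (forall i, measurable (A i)) ->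
    P (\bigcap_(i in [set` J]) (X i @^-1` A i)) =
    (\prod_(i <- J) P (X i @^-1` A i))%E.

Definition iid_std_normal (disp : measure_display)
    (T : measurableType disp) (R : realType) (P : probability T R)
    (I : choiceType) (X : I -> {RV P >-> R}) : Prop :=
  mutually_independent X /\
  forall (i : I) (A : set R), measurable A ->
    distribution P (X i) A = normal_prob 0 1 A.

(* Main.v *)
Require Import Defs.
From mathcomp Require Import all_boot all_order all_algebra.
From mathcomp Require Import finmap.
From mathcomp Require Import all_classical all_reals all_analysis.
From mathcomp Require Import measurable_realfun ring lra zify.

(** Disagreement percolation. Take two boundary conditions and reveal a free spin
    next to a disagreeing site, coupling the two conditional laws optimally: the
    disagreement spreads to a site v with probability at most p v, a bound valid
    for all surroundings of v.  Hence the total variation distance on D is at most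
    the total weight (product of the p v) of the self-avoiding paths from the
    exterior boundary of D to that of L.

    When |h v| >= delta, a large H pins the spin at v and makes p v tiny; otherwise
    use p v = 1.  Weak sites (|h v| < delta) are rare for small delta.  By
    Borel-Cantelli, almost surely all long self-avoiding paths from a given x are
    weak at no more than half of their sites, so their weights beat both the number
    of paths and the factor exp(length).  The weights are bounded by quantities
    depending on delta and d only, which is why C6 does not see beta and H. *)

Set Implicit Arguments.
Unset Strict Implicit.
Unset Printing Implicit Defensive.

Import Order.TTheory GRing.Theory Num.Theory.
Import numFieldNormedType.Exports.

Local Open Scope classical_set_scope.
Local Open Scope ring_scope.

(** * The disagreement bound for finite spin systems *)

Section FiniteSpinSystem.
Variables (R : realFieldType) (V : finType) (w : {ffun V -> bool} -> R).
Hypothesis w_gt0 : forall s, 0 < w s.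
Implicit Types (A : {set V}) (s t tau : {ffun V -> bool}) (v : V).
Implicit Types f : {ffun V -> bool} -> R.

Definition agree_on A tau s := [forall u in A, s u == tau u].

Lemma agree_onP A tau s : reflect {in A, s =1 tau} (agree_on A tau s).
Proof.
apply: (iffP forall_inP) => h u uA; first exact/eqP/h.
exact/eqP/h.
Qed.

Definition upd s v b : {ffun V -> bool} := [ffun u => if u == v then b else s u].

Definition overwrite A tau s : {ffun V -> bool} :=
  [ffun u => if u \in A then tau u else s u].

Definition disagreement A s t := [set u in A | s u != t u].

Definition Zsum A tau f := \sum_(s | agree_on A tau s) w s * f s.

Definition cond_mean A tau f := Zsum A tau f / Zsum A tau (fun=> 1).

Lemma Zsum_gt0 A tau : 0 < Zsum A tau (fun=> 1).
Proof.
rewrite /Zsum (bigD1 tau) /=; last exact/agree_onP.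
apply: ltr_wpDr; last by rewrite mulr1.
by apply: sumr_ge0 => s _; rewrite mulr1 ltW.
Qed.

Lemma cond_mean01 A tau f :
  (forall s, 0 <= f s <= 1) -> 0 <= cond_mean A tau f <= 1.
Proof.
move=> f01; have Z0 := Zsum_gt0 A tau.
apply/andP; split.
  apply: divr_ge0 (ltW Z0); apply: sumr_ge0 => s _.
  by apply: mulr_ge0; [exact: ltW | case/andP: (f01 s)].
rewrite ler_pdivrMr // mul1r; apply: ler_sum => s _.
by apply: ler_wpM2l; [exact: ltW | case/andP: (f01 s)].
Qed.

Lemma agree_split A tau v s : v \notin A ->
  agree_on A tau s = agree_on (v |: A) (upd tau v (s v)) s.
Proof.
move=> vA; apply/agree_onP/agree_onP => h u.
  rewrite !inE ffunE; case: eqVneq => [-> //|_ /=]; exact: h.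
move=> uA; have := h u; rewrite !inE ffunE uA orbT => /(_ isT).
by case: eqVneq => // uv; rewrite -uv uA in vA.
Qed.

Lemma Zsum_split A tau v f : v \notin A ->
  Zsum A tau f = Zsum (v |: A) (upd tau v true) f
               + Zsum (v |: A) (upd tau v false) f.
Proof.
move=> vA; rewrite /Zsum (bigID (fun s => s v)) /=.
congr (_ + _); apply: eq_bigl => s; rewrite (agree_split _ _ vA).
  case svE: (s v); rewrite ?andbT ?andbF //; symmetry; apply/negbTE/agree_onP.
  by move=> /(_ v); rewrite !inE eqxx ffunE eqxx svE => /(_ isT).
case svE: (s v); rewrite ?andbT ?andbF //; symmetry; apply/negbTE/agree_onP.
by move=> /(_ v); rewrite !inE eqxx ffunE eqxx svE => /(_ isT).
Qed.

Lemma upd_upd s v b c : upd (upd s v b) v c = upd s v c.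
Proof. by apply/ffunP => u; rewrite !ffunE; case: eqVneq. Qed.

Lemma upd_id s v : upd s v (s v) = s.
Proof. by apply/ffunP => u; rewrite !ffunE; case: eqVneq => // ->. Qed.

Lemma agree_upd A tau v b c s : v \notin A ->
  agree_on (v |: A) (upd tau v b) s -> agree_on (v |: A) (upd tau v c) (upd s v c).
Proof.
move=> vA /agree_onP h; apply/agree_onP => u.
by move=> /h; rewrite !ffunE; case: eqVneq.
Qed.

(** Setting the spin at [v] to [c] maps the configurations with value [b] there bijectively onto
    those with value [c], so the comparison of single weights can be summed. *)
Lemma Zsum_flip A tau v b c (q : R) : v \notin A ->
  (forall s, w (upd s v c) <= q * w (upd s v b)) ->
  Zsum (v |: A) (upd tau v c) (fun=> 1)
    <= q * Zsum (v |: A) (upd tau v b) (fun=> 1).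
Proof.
move=> vA hq; rewrite /Zsum mulr_sumr.
rewrite (reindex_onto (fun s => upd s v c) (fun s => upd s v b)) /=; last first.
  move=> s /agree_onP /(_ v); rewrite !inE eqxx ffunE eqxx => /(_ isT) <-.
  by rewrite upd_upd upd_id.
rewrite (eq_bigl (agree_on (v |: A) (upd tau v b))); last first.
  move=> s; rewrite upd_upd; apply/andP/idP => [[h /eqP <-]|h].
    by have := agree_upd b vA h; rewrite upd_upd.
  split; first exact: agree_upd h.
  by move/agree_onP: h => /(_ v); rewrite !inE eqxx ffunE eqxx => /(_ isT) <-; rewrite upd_id.
apply: ler_sum => s /agree_onP /(_ v); rewrite !inE eqxx ffunE eqxx => /(_ isT) sv.
by rewrite !mulr1 -{2}(upd_id s v) sv.
Qed.

Definition prob_plus A tau v :=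
  Zsum (v |: A) (upd tau v true) (fun=> 1) / Zsum A tau (fun=> 1).

Lemma prob_plus01 A tau v : v \notin A -> 0 <= prob_plus A tau v <= 1.
Proof.
move=> vA; have Z0 := Zsum_gt0 A tau; rewrite /prob_plus.
rewrite divr_ge0 ?(ltW Z0) ?(ltW (Zsum_gt0 _ _)) //= ler_pdivrMr // mul1r.
by rewrite (Zsum_split _ _ vA) lerDl ltW // Zsum_gt0.
Qed.

Lemma cond_mean_split A tau v f : v \notin A ->
  cond_mean A tau f =
    prob_plus A tau v * cond_mean (v |: A) (upd tau v true) f
    + (1 - prob_plus A tau v) * cond_mean (v |: A) (upd tau v false) f.
Proof.
move=> vA; rewrite /prob_plus /cond_mean !(Zsum_split tau _ vA).
have := Zsum_gt0 (v |: A) (upd tau v true).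
have := Zsum_gt0 (v |: A) (upd tau v false).
move: (Zsum _ _ (fun=> 1)) (Zsum _ _ (fun=> 1)) => a b a0 b0.
by field; rewrite !gt_eqF ?addr_gt0.
Qed.

(* The favoured spin value must not depend on the surroundings: this is what makes
   any two conditional laws at [v] close to each other. *)
Definition pinned v (q : R) :=
  [\/ 1 <= q, forall s, w (upd s v false) <= q * w (upd s v true)
    | forall s, w (upd s v true) <= q * w (upd s v false)].

(** For [q < 1] the same value is favoured under [tau] and [tau'], so both probabilities lie in
    [[0, q]] or both lie in [[1 - q, 1]]. *)
Lemma prob_plus_dist A tau tau' v (q : R) : v \notin A -> 0 <= q ->
  pinned v q -> `|prob_plus A tau v - prob_plus A tau' v| <= q.
Proof.
move=> vA q0 pin.
have [/andP[a0 a1] /andP[b0 b1]] := (prob_plus01 tau vA, prob_plus01 tau' vA).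
suff [q1|[[h1 h2]|[h1 h2]]] : 1 <= q \/
   (1 - prob_plus A tau v <= q /\ 1 - prob_plus A tau' v <= q) \/
   (prob_plus A tau v <= q /\ prob_plus A tau' v <= q).
- by rewrite ler_norml; lra.
- by rewrite ler_norml; lra.
- by rewrite ler_norml; lra.
case: pin => [q1|h|h]; [by left|right; left|right; right].
  suff H t : 1 - prob_plus A t v <= q by split; exact: H.
  have Z0 := Zsum_gt0 A t.
  rewrite lerBlDl -lerBlDr ler_pdivlMr // mulrBl mul1r lerBlDr.
  rewrite (Zsum_split t _ vA) lerD2l mulrDr.
  apply: le_trans (Zsum_flip _ vA h) _; rewrite lerDl.
  by rewrite mulr_ge0 // ltW // Zsum_gt0.
suff H t : prob_plus A t v <= q by split; exact: H.
have Z0 := Zsum_gt0 A t.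
rewrite ler_pdivrMr // (Zsum_split t _ vA) mulrDr.
apply: le_trans (Zsum_flip _ vA h) _; rewrite lerDr.
by rewrite mulr_ge0 // ltW // Zsum_gt0.
Qed.

(** The optimal coupling of two coins in algebraic form: for [b <= a] the outcomes agree with masses
    [b] and [1 - a] and differ with mass [a - b <= p]; only a difference costs the extra [g]. *)
Lemma mix_dist (a b f1 f0 g1 g0 T g p : R) :
  0 <= a <= 1 -> 0 <= b <= 1 -> `|a - b| <= p -> 0 <= g ->
  `|f1 - g1| <= T -> `|f0 - g0| <= T -> `|f1 - g0| <= T + g ->
  `|f0 - g1| <= T + g ->
  `|(a * f1 + (1 - a) * f0) - (b * g1 + (1 - b) * g0)| <= T + p * g.
Proof.
move=> /andP[a0 a1] /andP[b0 b1] abp g0' h11 h00 h10 h01.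
have [ba|/ltW ab] := leP b a.
  have -> : (a * f1 + (1 - a) * f0) - (b * g1 + (1 - b) * g0) =
    b * (f1 - g1) + (1 - a) * (f0 - g0) + (a - b) * (f1 - g0) by ring.
  apply: le_trans (ler_normD _ _) _; apply: le_trans (lerD (ler_normD _ _) (lexx _)) _.
  rewrite !normrM (ger0_norm b0) (ger0_norm (x := 1 - a)) ?subr_ge0 //.
  have abp' := abp; rewrite ger0_norm ?subr_ge0 // in abp'.
  have := ler_wpM2l b0 h11; have ha : 0 <= 1 - a by lra.
  have := ler_wpM2l ha h00; have := ler_wpM2l (normr_ge0 (a - b)) h10.
  rewrite (ger0_norm (x := a - b)) ?subr_ge0 //.
  have := ler_wpM2r g0' abp'; lra.
have -> : (a * f1 + (1 - a) * f0) - (b * g1 + (1 - b) * g0) =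
  a * (f1 - g1) + (1 - b) * (f0 - g0) + (b - a) * (f0 - g1) by ring.
apply: le_trans (ler_normD _ _) _; apply: le_trans (lerD (ler_normD _ _) (lexx _)) _.
rewrite !normrM (ger0_norm a0) (ger0_norm (x := 1 - b)) ?subr_ge0 //.
have abp' := abp; rewrite distrC ger0_norm ?subr_ge0 // in abp'.
have := ler_wpM2l a0 h11; have ha : 0 <= 1 - b by lra.
have := ler_wpM2l ha h00; have := ler_wpM2l (normr_ge0 (b - a)) h01.
rewrite (ger0_norm (x := b - a)) ?subr_ge0 //.
have := ler_wpM2r g0' abp'; lra.
Qed.

Lemma disagreement_upd A tau tau' v b : v \notin A ->
  disagreement (v |: A) (upd tau v b) (upd tau' v b) = disagreement A tau tau'.
Proof.
move=> vA; apply/finset.setP => u; rewrite !inE !ffunE.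
by case: eqVneq => [->|//]; rewrite eqxx (negbTE vA).
Qed.

Lemma disagreement_updN A tau tau' v b : v \notin A ->
  disagreement (v |: A) (upd tau v b) (upd tau' v (~~ b))
  = v |: disagreement A tau tau'.
Proof.
move=> vA; apply/finset.setP => u; rewrite !inE !ffunE.
by case: eqVneq => [->|//]; case: b.
Qed.

(** * Weights of self-avoiding paths and the spread of disagreement *)

Variables (e : rel V) (p : V -> R) (D B : {set V}).
Hypothesis p_ge0 : forall v, 0 <= p v.

(* Total weight of the self-avoiding paths from [y] to a site of [B] whose later
   sites avoid [A] and [D]; the first argument bounds the length. *)
Fixpoint green n A y : R := (y \in B)%:R +
  if n is n'.+1 then
    \sum_(v | [&& e y v, v \notin A & v \notin D]) p v * green n' (v |: A) v
  else 0.

Lemma green_ge0 n A y : 0 <= green n A y.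
Proof.
elim: n A y => [|n IH] A y /=; first by rewrite addr0 ler0n.
by apply: addr_ge0; rewrite ?ler0n // sumr_ge0 // => v _; rewrite mulr_ge0.
Qed.

Lemma green_mono n A A' y : A \subset A' -> green n A' y <= green n.+1 A y.
Proof.
elim: n A A' y => [|n IH] A A' y AA'.
  rewrite /= lerD2l sumr_ge0 // => v _; rewrite mulr_ge0 // addr0; exact: ler0n.
have -> : green n.+2 A y = (y \in B)%:R +
    \sum_(v | [&& e y v, v \notin A & v \notin D]) p v * green n.+1 (v |: A) v by [].
rewrite [leLHS]/= lerD2l.
rewrite [leRHS](bigID (fun v => v \notin A')) /=; apply: ler_wpDr.
  by apply: sumr_ge0 => v _; rewrite mulr_ge0 // (green_ge0 n.+1).
rewrite (eq_bigl (fun v => [&& e y v, v \notin A & v \notin D] && (v \notin A'))).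
  by apply: ler_sum => v _; apply: ler_wpM2l => //; apply: IH; apply: finset.setUS.
move=> v; case: (e y v) => //=; case vA': (v \in A'); rewrite /= ?andbF //.
by rewrite andbT; case vA : (v \in A) => //; rewrite (fintype.subsetP AA' _ vA) in vA'.
Qed.

(** Paths from [y] that never visit [v] and paths whose first step goes to [v] are disjoint families
    among those counted on the right. *)
Lemma green_step n A y v : e y v -> v \notin A -> v \notin D ->
  green n (v |: A) y + p v * green n (v |: A) v <= green n.+1 A y.
Proof.
move=> yv vA vD.
have Pv : [&& e y v, v \notin A & v \notin D] by rewrite yv vA.
rewrite [leRHS]/= (bigD1 v) //= addrCA [leLHS]addrC lerD2l.
case: n => [|n].
  by rewrite /= addr0 lerDl sumr_ge0 // => u _; rewrite mulr_ge0 // (green_ge0 0).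
rewrite [leLHS]/= lerD2l; set P := (X in _ <= \sum_(i | X i) _).
rewrite (eq_bigl P); last first.
  by move=> u; rewrite /P !inE negb_or; case: (e y u); case: (u \in A); case: (u \in D); case: (u == v).
apply: ler_sum => u _; apply: ler_wpM2l => //; apply: green_mono.
by rewrite finset.setUS // finset.subsetUr.
Qed.

Hypothesis D_bnd : forall y v, v \in D -> y \notin D -> e y v -> y \in B.
Variable A0 : {set V}.
Hypothesis p_pinned : forall v, v \notin A0 -> pinned v (p v).

Hypothesis markov : forall A tau tau',
  (forall y v, y \in disagreement A tau tau' -> v \notin A -> ~~ e y v) ->
  exists2 c, 0 < c & forall s, agree_on A tau s -> w (overwrite A tau' s) = c * w s.

(** Overwriting the spins of [A] leaves [f] unchanged, as [f] sees only [D], and the factor [c]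
    cancels in the quotient. *)
Lemma cond_mean_markov A tau tau' f : [disjoint A & D]%B ->
  (forall s t, {in D, s =1 t} -> f s = f t) ->
  (forall y v, y \in disagreement A tau tau' -> v \notin A -> ~~ e y v) ->
  cond_mean A tau f = cond_mean A tau' f.
Proof.
move=> AD fD /markov[c c0 hc].
have H g : (forall s t, {in D, s =1 t} -> g s = g t) ->
    Zsum A tau' g = c * Zsum A tau g.
  move=> gD; rewrite /Zsum mulr_sumr.
  rewrite (reindex_onto (overwrite A tau') (overwrite A tau)) /=; last first.
    move=> s /agree_onP hs; apply/ffunP => u; rewrite !ffunE.
    by case: (boolP (u \in A)) => [/hs <-|_].
  rewrite (eq_bigl (agree_on A tau)); last first.
    move=> s; apply/andP/agree_onP => [[_ /eqP/ffunP hs] u uA|hs].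
      by have := hs u; rewrite !ffunE uA.
    split; first by apply/agree_onP => u uA; rewrite ffunE uA.
    by apply/eqP/ffunP => u; rewrite !ffunE; case: (boolP (u \in A)) => [/hs <-|_].
  apply: eq_bigr => s /hc ->; rewrite mulrA; congr (_ * _); apply: gD => u uD.
  by rewrite ffunE; case: ifP => // uA; rewrite (disjointFr AD uA) in uD.
rewrite /cond_mean !H // -mulf_div divff ?mul1r //.
by rewrite gt_eqF.
Qed.

(** Induction on the number of unrevealed sites. Each step reveals a neighbour [v] of a disagreeing
    site [y] and couples the spins there; once no such [v] is left, the Markov property makes the
    two means equal. *)
Lemma cond_mean_dist n A tau tau' f :
  (#|~: A| <= n)%N -> A0 \subset A -> [disjoint A & D]%B ->
  (forall s t, {in D, s =1 t} -> f s = f t) -> (forall s, 0 <= f s <= 1) ->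
  `|cond_mean A tau f - cond_mean A tau' f|
    <= \sum_(y in disagreement A tau tau') green n A y.
Proof.
move=> + + + fD f01.
have f1 A' t t' : `|cond_mean A' t f - cond_mean A' t' f| <= 1.
  have /andP[? ?] := cond_mean01 A' t f01.
  have /andP[? ?] := cond_mean01 A' t' f01.
  by rewrite ler_norml; lra.
elim: n A tau tau' => [|n IH] A tau tau' cA A0A AD.
all: have [/existsP[y /existsP[v /and3P[yW vA yv]]]|noyv] :=
  boolP [exists y, [exists v, [&& y \in disagreement A tau tau', v \notin A & e y v]]]; last first.
1,3: rewrite (@cond_mean_markov A tau tau') ?subrr ?normr0 //;
  [by apply: sumr_ge0 => y _; apply: green_ge0 | move=> y v yW vA; apply: contra noyv => yv;
  by apply/existsP; exists y; apply/existsP; exists v; rewrite yW vA].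
  move: cA; rewrite leqn0 cards_eq0 => /eqP/finset.setP/(_ v).
  by rewrite !inE vA.
have yA : y \in A by move: yW; rewrite inE => /andP[].
(* If [v] is in [D], then [y] is in [B], so its term is at least 1 and the trivial bound
   suffices. *)
have [vD|vD] := boolP (v \in D).
  apply: le_trans (f1 _ _ _) _; rewrite (bigD1 y) //=.
  apply: ler_wpDr; first by apply: sumr_ge0 => u _; apply: (green_ge0 n.+1).
  rewrite (D_bnd vD _ yv) ?(disjointFr AD yA) // lerDl.
  by apply: sumr_ge0 => u _; rewrite mulr_ge0 // green_ge0.
rewrite !(cond_mean_split _ _ vA).
(* [T] is the bound when the coupled spins at [v] agree; otherwise [v] joins the disagreement and
   adds [green n (v |: A) v]. *)
pose T := \sum_(u in disagreement A tau tau') green n (v |: A) u.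
have cA' : (#|~: (v |: A)| <= n)%N.
  by rewrite -ltnS (leq_trans _ cA) // proper_card // properE finset.setCS finset.subsetUr /=;
    apply/subsetPn; exists v; rewrite !inE ?eqxx ?vA.
have A0A' : A0 \subset v |: A by rewrite (fintype.subset_trans A0A) ?finset.subsetUr.
have AD' : [disjoint v |: A & D]%B.
  by rewrite finset.disjoints_subset finset.subUset finset.sub1set inE vD -finset.disjoints_subset.
have vW : v \notin disagreement A tau tau' by rewrite inE (negbTE vA).
have vA0 : v \notin A0 by apply: contra vA => /(fintype.subsetP A0A).
apply: (@le_trans _ _ (T + p v * green n (v |: A) v)).
  apply: mix_dist; rewrite ?prob_plus01 ?green_ge0 //.
  - exact: prob_plus_dist (p_pinned vA0).
  - apply: le_trans (IH _ _ _ cA' A0A' AD') _.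
    by rewrite disagreement_upd.
  - apply: le_trans (IH _ _ _ cA' A0A' AD') _.
    by rewrite disagreement_upd.
  - apply: le_trans (IH _ _ _ cA' A0A' AD') _.
    by rewrite (@disagreement_updN _ _ _ _ true) // big_setU1 //= addrC.
  - apply: le_trans (IH _ _ _ cA' A0A' AD') _.
    by rewrite (@disagreement_updN _ _ _ _ false) // big_setU1 //= addrC.
rewrite /T (bigD1 y) //= [leRHS](bigD1 y) //= addrAC; apply: lerD.
  exact: green_step.
by apply: ler_sum => u _; apply: green_mono; rewrite finset.subsetUr.
Qed.

End FiniteSpinSystem.

(** At most [m ^ l] paths of length [l] leave [y0], each of weight at most [r * k ^+ l], and
    [m * k <= 1/2]: the geometric series sums to at most [2 * r]. [belast] omits [y0], which carries
    no weight. *)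
Lemma green_decay (R : realFieldType) (V : finType) (e : rel V) (p : V -> R)
    (D B : {set V}) (m : nat) (k r : R) (y0 : V) :
  symmetric e -> (forall v, 0 <= p v) ->
  (forall y, #|[pred v | e y v]| <= m)%N -> 0 <= k -> 0 <= r ->
  2 * m%:R * k <= 1 ->
  (forall y t, y \in B -> path e y t -> last y t = y0 -> uniq (y :: t) ->
    \prod_(u <- belast y t) p u <= r * k ^+ size t) ->
  forall n (A : {set V}), y0 \in A -> green e p D B n A y0 <= 2 * r.
Proof.
move=> e_sym p0 deg k0 r0 mk hit.
(* The induction carries the path walked so far, reversed, because the hypothesis bounds products
   along whole paths and not single factors. *)
suff H n (A : {set V}) y t : path e y t -> last y t = y0 -> uniq (y :: t) ->
    {subset y :: t <= A} ->
    (\prod_(u <- belast y t) p u) * green e p D B n A y <= 2 * r * k ^+ size t.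
  move=> n A y0A; have := @H n A y0 [::] isT erefl isT.
  rewrite big_nil mul1r expr0 mulr1; apply=> u.
  by rewrite inE => /eqP ->.
have w0 (l : seq V) : 0 <= \prod_(u <- l) p u by apply: prodr_ge0.
have hit' z l : path e z l -> last z l = y0 -> uniq (z :: l) ->
  (\prod_(u <- belast z l) p u) * (z \in B)%:R <= r * k ^+ size l.
  move=> pl ll ul; case: (boolP (z \in B)) => zB; rewrite ?mulr1 ?mulr0.
    exact: hit.
  by rewrite mulr_ge0 ?exprn_ge0.
elim: n A y t => [|n IH] A y t pt lt ut tA.
  rewrite /= addr0; apply: le_trans (hit' _ _ pt lt ut) _.
  have := mulr_ge0 r0 (exprn_ge0 (size t) k0); lra.
rewrite /= mulrDr.
apply: (@le_trans _ _ (r * k ^+ size t + m%:R * (2 * r * k ^+ (size t).+1))); last first.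
  rewrite exprS; have := mulr_ge0 r0 (exprn_ge0 (size t) k0) => q0.
  by have := ler_wpM2l q0 mk; lra.
apply: lerD; first exact: hit'.
rewrite mulr_sumr.
apply: (@le_trans _ _ (\sum_(v | e y v) 2 * r * k ^+ (size t).+1)).
  rewrite (bigID (fun v => (v \notin A) && (v \notin D)) (e y)) /=; apply: ler_wpDr.
    by apply: sumr_ge0 => v _; rewrite mulr_ge0 ?exprn_ge0 // mulr_ge0.
  apply: ler_sum => v /and3P[yv vA vD].
  have := IH (v |: A) v (y :: t); rewrite /= big_cons e_sym yv pt.
  rewrite mulrA [_ * p v]mulrC; apply=> //.
    move: (ut) => /= ->; rewrite andbT; apply/negP => /tA; exact/negP.
  move=> u; rewrite inE => /orP[/eqP ->|/tA]; rewrite !inE ?eqxx //.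
  by move=> ->; rewrite orbT.
rewrite sumr_const -[leLHS]mulr_natl; apply: ler_wpM2r.
  by rewrite mulr_ge0 ?exprn_ge0 // mulr_ge0.
rewrite ler_nat; exact: deg.
Qed.

(** * Ising weights *)

Section IsingWeight.
Variables (R : realType) (V : finType) (J : V -> V -> R) (g : V -> R).
Implicit Types (s : {ffun V -> bool}).

Definition ising_energy s : R :=
  (\sum_a \sum_b J a b * (spin R (s a) * spin R (s b)))
  + \sum_a g a * spin R (s a).

Definition ising_weight s := expR (ising_energy s).

(** Only bonds meeting [v] change, each by at most twice its coupling; the field term changes by
    exactly [2 * (spin R b * g v)]. *)
Lemma ising_energy_flip (K : R) s v b :
  (forall a c, 0 <= J a c) -> \sum_c (J v c + J c v) <= K ->
  ising_energy (upd s v b) - ising_energy (upd s v (~~ b))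
    <= 2 * K + 2 * (spin R b * g v).
Proof.
move=> J0 JK; rewrite /ising_energy opprD addrACA -!sumrB; apply: lerD.
  apply: (@le_trans _ _ (\sum_a \sum_c J a c * (2 * ((a == v)%:R + (c == v)%:R)))).
    apply: ler_sum => a _; rewrite -sumrB; apply: ler_sum => c _.
    rewrite -mulrBr; apply: ler_wpM2l => //; rewrite !ffunE /spin.
    by case: (a == v); case: (c == v); case: b; case: (s a); case: (s c) => /=; lra.
  suff -> : \sum_a \sum_c J a c * (2 * ((a == v)%:R + (c == v)%:R)) =
    2 * \sum_c (J v c + J c v) by rewrite ler_pM2l.
  transitivity (2 * (\sum_a \sum_c (J a c * (a == v)%:R + J a c * (c == v)%:R))).
    rewrite mulr_sumr; apply: eq_bigr => a _; rewrite mulr_sumr.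
    by apply: eq_bigr => c _; ring.
  congr (_ * _); rewrite big_split /=.
  under eq_bigr do rewrite big_split /=.
  rewrite big_split /=; congr (_ + _).
    rewrite (bigD1 v) //= [X in _ + X]big1 ?addr0; last first.
      by move=> a /negbTE av; apply: big1 => c _; rewrite av mulr0.
    by apply: eq_bigr => c _; rewrite eqxx mulr1.
  apply: eq_bigr => a _; rewrite (bigD1 v) //= big1 ?addr0 ?eqxx ?mulr1 //.
  by move=> c /negbTE cv; rewrite cv mulr0.
rewrite (bigD1 v) //= big1 ?addr0.
  by rewrite !ffunE eqxx; case: b => /=; rewrite /spin; lra.
by move=> a /negbTE av; rewrite !ffunE av subrr.
Qed.

(** The sign of [g v] is the favoured value at [v], whatever the other spins are. *)
Lemma ising_weight_pinned (K q : R) v :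
  (forall a c, 0 <= J a c) -> \sum_c (J v c + J c v) <= K ->
  expR (2 * K - 2 * `|g v|) <= q -> pinned ising_weight v q.
Proof.
move=> J0 JK Kq; have flip b s := ising_energy_flip s b J0 JK.
have E b s : ising_energy (upd s v b) - ising_energy (upd s v (~~ b))
    <= 2 * K - 2 * `|g v| ->
    ising_weight (upd s v b) <= q * ising_weight (upd s v (~~ b)).
  move=> h; rewrite -ler_pdivrMr ?expR_gt0 // -expRN -expRD.
  by apply: le_trans Kq; rewrite ler_expR.
have [g0|g0] := leP 0 (g v).
  apply: Or32 => s; apply: (E false); apply: le_trans (flip _ _) _.
  by rewrite ger0_norm // /spin; lra.
apply: Or33 => s; apply: (E true); apply: le_trans (flip _ _) _.
by rewrite ltr0_norm // /spin; lra.
Qed.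

(** A site of [A] adjacent to the outside has the same spin under [tau] and [tau'], so bonds leaving
    [A] keep their energy. The change comes from terms inside [A], which do not depend on [s]. *)
Lemma ising_weight_markov (e : rel V) (A : {set V}) tau tau' :
  symmetric e -> (forall a b, ~~ e a b -> J a b = 0) ->
  (forall y v, y \in disagreement A tau tau' -> v \notin A -> ~~ e y v) ->
  exists2 c, 0 < c & forall s, agree_on A tau s ->
    ising_weight (overwrite A tau' s) = c * ising_weight s.
Proof.
move=> e_sym Je noyv.
pose bond s a b := if (a \in A) && (b \in A) then J a b * (spin R (s a) * spin R (s b)) else 0.
pose field s a := if a \in A then g a * spin R (s a) else 0.
pose E s := \sum_a \sum_b bond s a b + \sum_a field s a.
exists (expR (E tau' - E tau)); first exact: expR_gt0.
move=> s /agree_onP st; rewrite -expRD; congr expR.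
suff h : ising_energy (overwrite A tau' s) - ising_energy s = E tau' - E tau.
  by rewrite -h subrK.
have -> : E tau' - E tau = \sum_a \sum_b (bond tau' a b - bond tau a b)
    + \sum_a (field tau' a - field tau a).
  rewrite /E opprD addrACA -sumrB -sumrB; congr (_ + _).
  by apply: eq_bigr => a _; rewrite sumrB.
rewrite /ising_energy opprD addrACA -!sumrB; congr (_ + _); last first.
  apply: eq_bigr => a _; rewrite /field !ffunE.
  by have [/st ->|_] := boolP (a \in A); rewrite ?subrr.
apply: eq_bigr => a _; rewrite -sumrB; apply: eq_bigr => b _.
rewrite /bond !ffunE.
have eq_spin x z : x \in A -> z \notin A -> e x z -> tau' x = s x.
  move=> xA zA xz; apply/eqP; rewrite eq_sym (st _ xA); case: eqVneq => // h.
  by have := noyv x z; rewrite inE xA h zA xz => /(_ isT isT).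
have [aA|aA] := boolP (a \in A); have [bA|bA] := boolP (b \in A) => /=.
- by rewrite !st.
- rewrite [RHS]subrr; have [ab|/Je ->] := boolP (e a b); last by rewrite !mul0r subrr.
  by rewrite (eq_spin a b) // subrr.
- rewrite [RHS]subrr; have [ab|/Je ->] := boolP (e a b); last by rewrite !mul0r subrr.
  by rewrite (eq_spin b a) // ?subrr // e_sym.
- by rewrite !subrr.
Qed.
End IsingWeight.

(** * Weak sites along lattice paths *)

Lemma card_neighbors d (x : site d) : (#|` neighbors x| <= 2 * d)%N.
Proof.
rewrite /neighbors cardfsU (leq_trans (leq_subr _ _)) // mul2n -addnn.
by apply: leq_add; apply: (leq_trans (leq_imfset_card _ _ _));
  rewrite -cardT card_ord.
Qed.

Fixpoint walks d n (x : site d) : seq (seq (site d)) :=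
  if n is n'.+1 then [seq u :: p | u <- neighbors x, p <- walks n' u]
  else [:: [::]].

Lemma mem_walks d (x : site d) p : path (@adj d) x p -> p \in walks (size p) x.
Proof.
elim: p x => [|u p IH] x //= /andP[xu /IH up].
by apply/allpairsPdep; exists u, p; split.
Qed.

Lemma size_walks d n (x : site d) : (size (walks n x) <= (2 * d) ^ n)%N.
Proof.
elim: n x => [|n IH] x //=; rewrite size_allpairs_dep sumnE big_map.
apply: (@leq_trans (\sum_(u <- neighbors x) (2 * d) ^ n)%N).
  by apply: leq_sum => u _; exact: IH.
rewrite big_const_seq count_predT iter_addn_0 mulnC expnS.
by rewrite leq_mul2r card_neighbors orbT.
Qed.

Lemma size_mem_walks d n (x : site d) p : p \in walks n x -> size p = n.
Proof.
elim: n x p => [|n IH] x p /=; first by rewrite inE => /eqP ->.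
by move=> /allpairsPdep[u [q [_ /IH <- ->]]].
Qed.

Lemma prod_if_count (R : realType) (T : eqType) (Q : pred T) (c : R) (s : seq T) :
  \prod_(u <- s) (if Q u then 1 else c) = c ^+ count (predC Q) s.
Proof.
elim: s => [|u s IH]; first by rewrite big_nil.
by rewrite big_cons IH /=; case: (Q u); rewrite /= ?mul1r ?add0n ?add1n ?exprS.
Qed.

Lemma measure_bigsetU_le disp (T : measurableType disp) (R : realType)
    (mu : {measure set T -> \bar R}) (I : Type) (s : seq I) (Q : pred I)
    (F : I -> set T) : (forall i, measurable (F i)) ->
  (mu (\big[setU/set0]_(i <- s | Q i) F i) <= \sum_(i <- s | Q i) mu (F i))%E.
Proof.
move=> mF; elim: s => [|i s IH]; first by rewrite !big_nil measure0.
rewrite !big_cons; case: ifP => // Qi.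
apply: le_trans (measureU2 _ _ _) _ => //; first exact: bigsetU_measurable.
by rewrite leeD2l.
Qed.

(** * Small balls under the standard normal law *)

Section NormalSmallBall.
Variable R : realType.

(** The density is at most its peak [k], so an interval of length [c / k] has mass at most [c]. *)
Lemma normal_prob_small_ball (c : R) : 0 < c ->
  exists2 delta : R, 0 < delta &
    (normal_prob 0 1 [set x : R | (`|x| < delta)%R] <= c%:E)%E.
Proof.
move=> c0; pose k : R := normal_peak 1.
have k0 : 0 < k by apply: normal_peak_gt0; rewrite oner_eq0.
exists (c / (2 * k)); first by rewrite divr_gt0 // mulr_gt0.
set dl := c / (2 * k).
have dl0 : 0 < dl by rewrite divr_gt0 // mulr_gt0.
have -> : [set x : R | `|x| < dl] = `]- dl, dl[%classic.
  by apply/seteqP; split => x /=; rewrite in_itv /= ltr_norml.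
rewrite /normal_prob.
set I := `]- dl, dl[%classic.
apply: (@le_trans _ _ (\int[lebesgue_measure]_(x in I) k%:E)%E).
  apply: ge0_le_integral => //.
  - exact: measurable_itv.
  - by move=> x _; rewrite lee_fin normal_pdf_ge0.
  - apply/measurable_EFinP; apply: measurable_funTS; exact: measurable_normal_pdf.
  - by move=> x _; rewrite lee_fin normal_pdf_ub // oner_eq0.
rewrite integral_cst; last exact: measurable_itv.
have mI : lebesgue_measure I = (dl + dl)%:E.
  by rewrite /I lebesgue_measure_itv /= lte_fin gtrN // -EFinD opprK.
rewrite [X in (_ * X)%E](_ : _ = (dl + dl)%:E) ?mI // -EFinM lee_fin.
suff -> : k * (dl + dl) = c by [].
by rewrite /dl; field; rewrite gt_eqF.
Qed.
End NormalSmallBall.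

(** * Borel-Cantelli for paths crowded with weak sites *)

Section WellPinnedPaths.
Variables (R : realType) (d : nat) (delta kappa : R).

(* A site with a weak field gets the trivial weight 1; every other site gets
   kappa^2, so a path with at most half of its sites weak has weight at most
   kappa per site. *)
Definition pin_weight (a : R) : R := if `|a| < delta then 1 else kappa ^+ 2.

Definition decays_from (h : site d -> R) (x : site d) (N : nat) :=
  forall p, path (@adj d) x p -> uniq (x :: p) -> (N <= size p)%N ->
    \prod_(u <- x :: p) pin_weight (h u) <= kappa ^+ (size p).+1.

Variables (disp : measure_display) (Omega : measurableType disp).
Variables (P : probability Omega R) (X : site d -> {RV P >-> R}).

Definition weak_on (J : {fset site d}) : set Omega :=
  \bigcap_(i in [set` J]) (X i @^-1` [set a | `|a| < delta]).

Definition crowded x n : set Omega :=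
  \big[setU/set0]_(p <- walks n x)
    \big[setU/set0]_(J <- fpowerset [fset u in x :: p]%fset | (n.+1 <= 2 * #|` J|)%N)
      weak_on J.

Lemma measurable_weak_on J : measurable (weak_on J).
Proof.
apply: fin_bigcap_measurable => [|i _]; first exact: finite_fset.
rewrite -[X in measurable X]setTI; apply: measurable_funP => //.
have -> : [set a : R | `|a| < delta] = `]- delta, delta[%classic.
  by apply/seteqP; split => x /=; rewrite in_itv /= ltr_norml.
exact: measurable_itv.
Qed.

Lemma measurable_crowded x n : measurable (crowded x n).
Proof.
apply: bigsetU_measurable => p _; apply: bigsetU_measurable => J _.
exact: measurable_weak_on.
Qed.

(** At least half of the [n.+1] sites are not weak, and each of these contributes [kappa ^+ 2]. *)
Lemma not_crowded_decay x n w p : 0 < kappa <= 1 ->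
  ~ crowded x n w -> path (@adj d) x p -> uniq (x :: p) -> size p = n ->
  \prod_(u <- x :: p) pin_weight (X u w) <= kappa ^+ n.+1.
Proof.
move=> /andP[k0 k1] ncr xp up sp; rewrite /pin_weight.
rewrite (prod_if_count (fun u => `|X u w| < delta)).
set Q := fun u : site d => `|X u w| < delta.
pose J := [fset u in seq.filter Q (x :: p)]%fset.
have cJ : #|` J| = count Q (x :: p).
  by rewrite card_fseq undup_id ?filter_uniq // size_filter.
have ct := count_predC Q (x :: p).
rewrite -exprM; apply: ler_wiXn2l; rewrite ?(ltW k0) //.
have [//|le] := leqP n.+1 (2 * count (predC Q) (x :: p)).
case: ncr; rewrite /crowded -bigcup_seq; exists p => /=.
  by rewrite -sp mem_walks.
rewrite -bigcup_seq_cond; exists J => /=.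
  apply/andP; split.
    by rewrite fpowersetE; apply/fsubsetP => u; rewrite !inE mem_filter => /andP[].
  by rewrite cJ; move: ct le; rewrite /= sp; lia.
by move=> u /=; rewrite !inE mem_filter => /andP[].
Qed.

(** By independence a set [J] with [2 * #|J| >= n.+1] is entirely weak with probability at most
    [(r ^+ 2) ^+ #|J| <= r ^+ n.+1]; the prefactor counts the walks and the subsets of their
    sites. *)
Lemma prob_crowded x n (r : R) : iid_std_normal X -> 0 <= r ->
  (normal_prob 0 1 [set a : R | (`|a| < delta)%R] <= (r ^+ 2)%:E)%E -> r <= 1 ->
  (P (crowded x n) <= ((2 * d) ^ n * 2 ^ n.+1)%:R%:E * (r ^+ n.+1)%:E)%E.
Proof.
move=> [indep law] r0 hr r1; rewrite /crowded.
have mw := measurable_weak_on.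
apply: le_trans (measure_bigsetU_le _ _ _ _) _ => [p|].
  exact: bigsetU_measurable.
apply: (@le_trans _ _ (\sum_(p <- walks n x) ((2 ^ n.+1)%:R * r ^+ n.+1)%:E)%E); last first.
  rewrite sumEFin -EFinM lee_fin big_const_seq count_predT iter_addr_0.
  rewrite -[leLHS]mulr_natl mulrA -natrM ler_wpM2r ?exprn_ge0 // ler_nat leq_mul2r.
  by rewrite size_walks orbT.
rewrite big_seq [leRHS]big_seq; apply: lee_sum => p /size_mem_walks sp.
apply: le_trans (measure_bigsetU_le _ _ _ mw) _.
apply: (@le_trans _ _ (\sum_(J <- fpowerset [fset u in x :: p]%fset) (r ^+ n.+1)%:E)%E).
  rewrite [leRHS](bigID (fun J : {fset site d} => (n.+1 <= 2 * #|` J|)%N)) /=.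
  apply: le_trans (leeDl _ _); last by apply: sume_ge0 => J _; rewrite lee_fin exprn_ge0.
  apply: lee_sum => J nJ; rewrite /weak_on.
  have mI : measurable [set a : R | `|a| < delta].
    have -> : [set a : R | `|a| < delta] = `]- delta, delta[%classic.
      by apply/seteqP; split => z /=; rewrite in_itv /= ltr_norml.
    exact: measurable_itv.
  rewrite (indep J (fun=> [set a : R | `|a| < delta])) //.
  have n0 : (0 <= normal_prob 0 1 [set a : R | (`|a| < delta)%R])%E.
    by apply: integral_ge0 => z _; rewrite lee_fin normal_pdf_ge0.
  have q0 := fine_ge0 n0.
  have fq : normal_prob 0 1 [set a : R | `|a| < delta]
      = (fine (normal_prob 0 1 [set a : R | `|a| < delta]))%:E.
    by rewrite fineK // ge0_fin_numE // (le_lt_trans hr) // ltry.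
  rewrite (eq_bigr (fun=> (fine (normal_prob 0 1 [set a : R | `|a| < delta]))%:E)); last first.
    by move=> i _; rewrite -fq; exact: law.
  rewrite fq lee_fin in hr.
  rewrite prodEFin lee_fin big_const_seq count_predT.
  rewrite iter_mulr_1.
  apply: (@le_trans _ _ ((r ^+ 2) ^+ #|` J|)).
    by apply: lerXn2r; rewrite ?nnegrE ?exprn_ge0.
  by rewrite -exprM; apply: ler_wiXn2l.
rewrite sumEFin lee_fin big_const_seq count_predT iter_addr_0 -[leLHS]mulr_natl.
apply: ler_wpM2r; first exact: exprn_ge0.
rewrite ler_nat card_fpowerset leq_pexp2l // card_fseq.
by rewrite (leq_trans (size_undup _)) //= sp.
Qed.

Lemma ae_decays_from : (0 < d)%N -> 0 < kappa <= 1 -> iid_std_normal X ->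
  (normal_prob 0 1 [set a : R | (`|a| < delta)%R] <= ((8 * d)%:R^-1 ^+ 2)%:E)%E ->
  {ae P, forall w : Omega, forall x : site d,
     exists N, decays_from (fun u => X u w) x N}.
Proof.
move=> d0 kappa01 iid hr.
have null x : P (lim_sup_set (crowded x)) = 0%E.
  apply: lim_sup_set_cvg0 => [n|]; first exact: measurable_crowded.
  apply: (@le_lt_trans _ _ (1 : R)%:E); last exact: ltry.
  (* With [r = 1 / (8 * d)] the [n]-th probability is at most [1 / 2 ^ n.+1], and these bounds sum
     to 1. *)
  apply: le_trans (epsilon_trick0 xpredT (@ler01 R)).
  apply: lee_nneseries => [//|n _].
  apply: le_trans (prob_crowded x n iid _ hr _) _.
  - by rewrite invr_ge0.
  - by rewrite invf_le1 ?ler1n ?ltr0n muln_gt0 //.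
  rewrite -EFinM lee_fin div1r exprVn -natrX ler_pdivrMr; last first.
    by rewrite ltr0n expn_gt0 muln_gt0 d0.
  rewrite mulrC ler_pdivlMr ?ltr0n ?expn_gt0 // -natrM ler_nat.
  rewrite (_ : 8 * d = 2 * d * 2 * 2)%N; last by lia.
  rewrite !(expnMn _ 2); apply: leq_mul => //; apply: leq_mul => //.
  by rewrite leq_pexp2l // muln_gt0 d0.
have aex x : \forall w \ae P, exists N, decays_from (fun u => X u w) x N.
  (* Off this null set, [crowded x k] fails for all [k] from some [n] on, and this [n] serves as
     [N]. *)
  exists (lim_sup_set (crowded x)); split => //.
    apply: bigcapT_measurable => n; apply: bigcup_measurable => k _.
    exact: measurable_crowded.
  move=> w /= nex n _ /=; apply: contrapT => ncr; apply: nex; exists n.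
  move=> p xp up np; apply: (not_crowded_decay kappa01 _ xp up erefl).
  by move=> cr; apply: ncr; exists (size p).
(* Sites are countable, so the quantifier over [x] can be moved inside the almost sure statement. *)
have := @ae_foralln _ _ _ P (fun n w => if choice.unpickle n is Some x then
   exists N, decays_from (fun u => X u w) x N else True).
move=> H.
have {}H : \forall w \ae P, forall n, if choice.unpickle n is Some x then
   exists N, decays_from (fun u => X u w) x N else True.
  apply: H => n; case: (choice.unpickle n) => [x|]; first exact: aex.
  exact: aeW.
apply: filterS H => w H x; have := H (choice.pickle x).
by rewrite choice.pickleK.
Qed.
End WellPinnedPaths.

(** * The Gibbs measures of the random field Ising model *)

Lemma adj_sym d : symmetric (@adj d).
Proof.
move=> u v; rewrite !adjE; apply: eq_existsb => i.
have E (a b c : site d) : (a == b + c) = (b == a - c).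
  by rewrite -subr_eq eq_sym.
by rewrite (E v u (delta_mx 0 i)) (E u v (delta_mx 0 i)) orbC.
Qed.

Lemma sum_sqr_le_sqr_sum (R : realDomainType) (I : Type) (s : seq I) (F : I -> R) :
  \sum_(i <- s) F i ^+ 2 <= (\sum_(i <- s) `|F i|) ^+ 2.
Proof.
elim: s => [|i s IH]; first by rewrite !big_nil expr0n.
rewrite !big_cons sqrrD real_normK ?num_real //.
rewrite -addrA lerD2l; apply: le_trans IH _; rewrite lerDr.
by rewrite mulrn_wge0 // mulr_ge0 // sumr_ge0.
Qed.

(** * Path length dominates Euclidean distance *)

Section Distance.
Variables (R : realType) (d : nat).
Implicit Types u v w : site d.

(** Mediates between the Euclidean norm, which it dominates, and the number of lattice steps, each
    of which changes it by at most 1. *)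
Definition l1_norm u : R := \sum_(i < d) `|((u 0 i)%:~R : R)|.

Lemma euclid_le_l1 u : euclid_norm R u <= l1_norm u.
Proof.
have l0 : 0 <= l1_norm u by apply: sumr_ge0.
rewrite /euclid_norm -[leRHS]ger0_norm // -(sqrtr_sqr (l1_norm u)).
by rewrite ler_wsqrtr // sum_sqr_le_sqr_sum.
Qed.

Lemma l1_norm_step u v w : adj u v -> l1_norm (u - w) <= 1 + l1_norm (v - w).
Proof.
move=> uv; apply: (@le_trans _ _ (l1_norm (u - v) + l1_norm (v - w))).
  rewrite /l1_norm -big_split /=; apply: ler_sum => i _.
  rewrite !mxE; apply: le_trans (ler_normD _ _).
  by rewrite -rmorphD /= subrKA.
rewrite lerD2r.
suff [i uvi] : exists i, forall j, `|((u - v) 0 j)%:~R| = (j == i)%:R :> R.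
  rewrite /l1_norm (eq_bigr _ (fun j _ => uvi j)) (bigD1 i) //= eqxx big1 ?addr0 //.
  by move=> j /negbTE ->.
move: uv; rewrite adjE => /existsP[i /orP[]/eqP ->]; exists i => j;
  rewrite !mxE eqxx /= eq_sym opprD ?opprK addrA subrr add0r; case: eqP => _ /=;
  by rewrite ?rmorphN /= ?normrN ?normr1 ?oppr0 ?normr0.
Qed.

Lemma path_distance u p : path (@adj d) u p ->
  euclid_norm R (u - last u p) <= (size p)%:R.
Proof.
move=> up; apply: le_trans (euclid_le_l1 _) _.
elim: p u up => [|v p IH] u /=.
  by move=> _; rewrite subrr /l1_norm big1 // => i _; rewrite mxE normr0.
move=> /andP[uv /IH vp]; apply: le_trans (l1_norm_step _ uv) _.
by rewrite -nat1r lerD2l.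
Qed.
End Distance.

Lemma sum_fsetU_disjoint (R : nmodType) (T : choiceType) (A B V : {fset T})
    (AV : (A `<=` V)%fset) (BV : (B `<=` V)%fset) (F : V -> R) :
  V = (A `|` B)%fset -> [disjoint A & B]%fset ->
  \sum_(a : V) F a = \sum_(a : A) F (fincl AV a) + \sum_(b : B) F (fincl BV b).
Proof.
move=> VE AB.
(* Extending [F] by 0 outside [V] turns all three sums into sums over lists of sites. *)
pose G x : R := if insub x is Some a then F a else 0.
have GE a : F a = G (val a) by rewrite /G valK.
transitivity (\sum_(x <- V) G x).
  by rewrite big_seq_fsetE; apply: eq_bigr => a _; rewrite GE.
transitivity (\sum_(x <- A) G x + \sum_(x <- B) G x); last first.
  by rewrite !big_seq_fsetE; congr (_ + _); apply: eq_bigr => a _; rewrite GE.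
rewrite -big_cat; apply: perm_big; apply: uniq_perm; rewrite ?fset_uniq //.
  rewrite cat_uniq !fset_uniq andbT /=; apply/hasPn => x xB.
  by apply/negP => xA; move/fdisjointP: AB => /(_ x xA); rewrite xB.
by move=> x; rewrite mem_cat VE inE.
Qed.

(** * The random field model as an Ising system with frozen boundary spins *)

Section BoundaryConditionsAsFrozenSpins.
Variables (R : realType) (d : nat) (L : {fset site d}).
Variables (beta H : R) (h : site d -> R).

Let B := ext_boundary L.
Let V := (L `|` B)%fset.
Let LV : (L `<=` V)%fset := fsubsetUl L B.
Let BV : (B `<=` V)%fset := fsubsetUr L B.

Lemma boundaryN (y : B) : val y \notin L.
Proof. by case/ext_boundaryP: (valP y). Qed.

Lemma disjoint_boundary : [disjoint L & B]%fset.
Proof.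
by apply/fdisjointP => x xL; apply/negP => /ext_boundaryP[]; rewrite xL.
Qed.

(** Halved because [ising_energy] runs over ordered pairs; pairs of boundary sites get 0 because
    [exponent] has no such terms. *)
Definition bond (a b : V) : R :=
  if adj (val a) (val b) && ((val a \in L) || (val b \in L)) then beta / 2 else 0.

Definition field (a : V) : R := if val a \in L then H * h (val a) else 0.

(** The final [false] is never reached, as each site of [V] lies in [L] or in its exterior
    boundary. *)
Definition glue (t : config L) (eta : config B) : {ffun V -> bool} :=
  [ffun a => if insub (val a) is Some x then t x
             else if insub (val a) is Some y then eta y else false].

Lemma glueL t eta x : glue t eta (fincl LV x) = t x.
Proof. by rewrite ffunE valK. Qed.

Lemma glueB t eta y : glue t eta (fincl BV y) = eta y.
Proof. by rewrite ffunE insubN ?boundaryN // valK. Qed.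

Definition shrink (s : {ffun V -> bool}) : config L := [ffun x => s (fincl LV x)].

Lemma glueK t eta : shrink (glue t eta) = t.
Proof. by apply/ffunP => x; rewrite !ffunE valK. Qed.

Lemma vertexP (a : V) : (exists x, a = fincl LV x) \/ (exists y, a = fincl BV y).
Proof.
case: a => a aV; have := aV; rewrite inE => /orP[aL|aB].
  by left; exists [` aL]%fset; apply: val_inj.
by right; exists [` aB]%fset; apply: val_inj.
Qed.

Lemma agree_glue t0 eta s :
  agree_on (fsub V B) (glue t0 eta) s = (glue (shrink s) eta == s).
Proof.
apply/agree_onP/eqP => [hs|<- a]; last first.
  rewrite in_fsub; case: (vertexP a) => [[x ->]|[y ->] _]; last by rewrite !glueB.
  by move=> /ext_boundaryP[]; rewrite (valP x).
apply/ffunP => a; case: (vertexP a) => [[x ->]|[y ->]].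
  by rewrite glueL ffunE.
by rewrite glueB hs ?glueB // in_fsub (valP y).
Qed.

(** Pairs inside [L] keep the factor 1/2 of [exponent]; a bond to the boundary is met in both
    orders, and its two halves add up to [beta]. *)
Lemma energy_glue t eta :
  ising_energy bond field (glue t eta) = exponent eta beta H h t.
Proof.
have split F := sum_fsetU_disjoint (R := R) LV BV F erefl disjoint_boundary.
rewrite /ising_energy /exponent !split; congr (_ + _); last first.
  rewrite [X in _ + X]big1 ?addr0 => [|y _]; last first.
    by rewrite /field /= (negbTE (boundaryN y)) mul0r.
  by rewrite mulr_sumr; apply: eq_bigr => x _; rewrite glueL /field /= (valP x) mulrA.
under eq_bigr do rewrite split.
under [X in _ + X]eq_bigr do rewrite split.
rewrite !big_split /= [X in _ + (_ + X)]big1 ?addr0 => [|y _]; last first.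
  apply: big1 => y' _; rewrite /bond /= (negbTE (boundaryN y)).
  by rewrite (negbTE (boundaryN y')) andbF mul0r.
rewrite -addrA; congr (_ + _).
  rewrite mulrA mulr_sumr; apply: eq_bigr => x _.
  rewrite mulr_sumr [RHS]big_mkcond; apply: eq_bigr => x' _.
  by rewrite !glueL /bond /= (valP x) andbT; case: ifP; rewrite ?mul0r.
rewrite [X in _ + X]exchange_big -big_split mulr_sumr; apply: eq_bigr => x _.
rewrite -big_split mulr_sumr [RHS]big_mkcond; apply: eq_bigr => y _ /=.
rewrite glueL glueB /bond /= (valP x) /= orbT !andbT adj_sym.
by case: ifP => _; rewrite ?mul0r ?addr0 //; field.
Qed.

(** Gluing [eta] on is a bijection from the configurations of [L] onto those of [V] that show [eta]
    on the boundary. [t0] is a filler on [L], where nothing is conditioned. *)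
Lemma gibbs_marginal_frozen (D : {fset site d}) (DL : (D `<=` L)%fset) t0 eta A :
  gibbs_marginal eta beta H h DL A =
  cond_mean (ising_weight bond field) (fsub V B) (glue t0 eta)
    (fun s => (Defs.restrict DL (shrink s) \in A)%:R).
Proof.
have E f : Zsum (ising_weight bond field) (fsub V B) (glue t0 eta) f =
    \sum_(t : config L) expR (exponent eta beta H h t) * f (glue t eta).
  rewrite /Zsum (reindex_onto (fun t => glue t eta) shrink) /=; last first.
    by move=> s; rewrite agree_glue => /eqP.
  apply: eq_big => [t|t _]; first by rewrite agree_glue glueK !eqxx.
  by rewrite /ising_weight energy_glue.
rewrite /cond_mean !E /gibbs_marginal /gibbs -mulr_suml; congr (_ / _).
  rewrite big_mkcond; apply: eq_bigr => t _; rewrite glueK.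
  by case: ifP => _; rewrite ?mulr1 ?mulr0.
by apply: eq_bigr => t _; rewrite mulr1.
Qed.

Lemma card_adj (a : V) : (#|[pred b : V | adj (val a) (val b)]| <= 2 * d)%N.
Proof.
apply: leq_trans (card_neighbors (val a)).
rewrite cardE -(size_map val); apply: uniq_leq_size.
  by rewrite map_inj_uniq ?enum_uniq //; exact: val_inj.
by move=> x /mapP[b]; rewrite mem_enum inE => ab ->.
Qed.

Lemma bond_degree a : 0 <= beta ->
  \sum_c (bond a c + bond c a) <= (2 * d)%:R * beta.
Proof.
move=> b0; apply: (@le_trans _ _ (\sum_(c : V | adj (val a) (val c)) beta)).
  rewrite [leRHS]big_mkcond; apply: ler_sum => c _.
  rewrite /bond (adj_sym (val c)).
  by case: (adj _ _) => /=; do ?case: ifP => _; lra.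
rewrite sumr_const -[leLHS]mulr_natl ler_wpM2r // ler_nat; exact: card_adj.
Qed.

(** The factor [expR (-1)] per site turns path length into decay in the Euclidean distance, while
    [k] pays for the number of paths; the 2 is the sum of the geometric series. *)
Lemma marginal_dist (q K : site d -> R) (k : R) (D : {fset site d})
    (DL : (D `<=` L)%fset) (e1 e2 : config B) A :
  0 <= beta -> 0 <= k -> 2 * (2 * d)%:R * k <= 1 ->
  (forall x, 0 <= q x) -> (forall x, 1 <= K x) ->
  (forall x, 1 <= q x \/
    expR (2 * ((2 * d)%:R * beta) - 2 * `|H * h x|) <= q x) ->
  (forall x p, path (@adj d) x p -> uniq (x :: p) ->
    \prod_(u <- x :: p) q u <= K x * (expR (-1) * k) ^+ (size p).+1) ->
  `|gibbs_marginal e1 beta H h DL A - gibbs_marginal e2 beta H h DL A|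
  <= \sum_(x <- ext_boundary D) \sum_(y <- B)
        2 * K x * expR (- 1 * euclid_norm R (x - y)).
Proof.
move=> b0 k0 dk q0 K1 qpin hit.
pose e : rel V := fun a b => adj (val a) (val b).
have e_sym : symmetric e by move=> a b; exact: adj_sym.
pose p (a : V) := q (val a).
(* [green_decay] needs one constant valid for every endpoint in the exterior boundary of [D], hence
   the sum over [x]. *)
pose r (y : site d) := \sum_(x <- ext_boundary D) K x * expR (- euclid_norm R (x - y)).
have K0 x : 0 <= K x by apply: le_trans (K1 x).
have term0 x y : 0 <= K x * expR (- euclid_norm R (x - y)).
  by rewrite mulr_ge0 ?expR_ge0.
have r0 y : 0 <= r y by apply: sumr_ge0.
pose t0 : config L := [ffun=> true].
rewrite !(gibbs_marginal_frozen DL t0).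
set f := fun s => _.
apply: le_trans (@cond_mean_dist _ _ (ising_weight bond field)
  (fun s => expR_gt0 _) e p (fsub V D) (fsub V (ext_boundary D)) (fun a => q0 _)
  _ (fsub V B) _ _ _ _ (glue t0 e1) (glue t0 e2) f (leqnn _) (subxx _) _ _ _) _.
- move=> y v; rewrite !in_fsub => vD yD yv; apply/ext_boundaryP; split => //.
  by exists (val v) => //; rewrite adj_sym.
- move=> v; rewrite in_fsub => vB.
  case: (qpin (val v)) => [q1|qe]; first by apply: Or31.
  apply: (@ising_weight_pinned _ _ _ _ ((2 * d)%:R * beta)).
  + by move=> a c; rewrite /bond; case: ifP => // _; rewrite divr_ge0.
  + exact: bond_degree.
  + suff -> : field v = H * h (val v) by [].
    by rewrite /field; have := valP v; rewrite inE (negbTE vB) orbF => ->.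
- move=> A' t t' noyv; apply: ising_weight_markov noyv => // a b.
  by rewrite /e /bond => /negbTE ->.
- rewrite disjoint_subset; apply/fintype.subsetP => a.
  rewrite in_fsub => /ext_boundaryP[aL _]; rewrite inE /= in_fsub.
  by apply: contra aL; move/fsubsetP: (DL); apply.
- move=> s t st; rewrite /f; congr (_ \in A)%:R; apply/ffunP => u.
  by rewrite !ffunE; apply: st; rewrite in_fsub /= (valP u).
- by move=> s; rewrite /f ler0n lern1 leq_b1.
have green_le (y : V) : val y \in B ->
    green e p (fsub V D) (fsub V (ext_boundary D)) #|~: fsub V B| (fsub V B) y
      <= 2 * r (val y).
  move=> yB; apply: (@green_decay _ _ _ _ _ _ (2 * d) k) => //.
  - by move=> a; exact: q0.
  - exact: card_adj.
  - move=> a t; rewrite in_fsub => aD at_ lt ut.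
    have ra (n : nat) : euclid_norm R (val a - val y) <= n%:R ->
        K (val a) * expR (-1) ^+ n <= r (val y).
      move=> an; rewrite /r (big_fsetD1 _ aD) /=; apply: ler_wpDr; first exact: sumr_ge0.
      by rewrite -expRM_natl mulrN1 ler_wpM2l // ler_expR lerN2.
    have ln : euclid_norm R (val a - val y) <= (size t)%:R.
      have := path_distance R (u := val a) (p := map val t).
      by rewrite size_map last_map lt; apply; rewrite path_map.
    apply: (@le_trans _ _ (K (val a) * expR (-1) ^+ size t * k ^+ size t)); last first.
      by rewrite ler_wpM2r ?exprn_ge0 // ra.
    (* The empty path, for a site on both exterior boundaries, has weight 1 and is covered by
       [1 <= K]. Otherwise dropping the endpoint [z] leaves exactly [size t] weighted sites. *)
    case/lastP: t at_ lt ut {ln} => [|l z] al lz ul.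
      by rewrite big_nil !expr0 !mulr1.
    rewrite belast_rcons size_rcons -mulrA -exprMn.
    have := hit (val a) (map val l); rewrite size_map path_map -map_cons big_map.
    apply; first by move: al; rewrite rcons_path => /andP[].
    rewrite map_inj_uniq; last exact: val_inj.
    by move: ul; rewrite -rcons_cons rcons_uniq => /andP[].
  - by rewrite in_fsub.
apply: (@le_trans _ _ (\sum_(y : V) if val y \in B then 2 * r (val y) else 0)).
  rewrite [leRHS](bigID (mem (disagreement (fsub V B) (glue t0 e1) (glue t0 e2)))) /=.
  apply: ler_wpDr.
    by apply: sumr_ge0 => y _; case: ifP => // _; rewrite mulr_ge0.
  apply: ler_sum => y; rewrite inE => /andP[+ _]; rewrite in_fsub => yB.
  by rewrite yB green_le.
rewrite (sum_fsetU_disjoint LV BV _ erefl disjoint_boundary) big1 ?add0r; last first.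
  by move=> x _; case: ifP => // /ext_boundaryP[]; rewrite (valP x).
rewrite exchange_big [leRHS]big_seq_fsetE; apply: ler_sum => y _ /=.
rewrite (valP y) /r mulr_sumr; apply: ler_sum => x _.
by rewrite mulN1r mulrA.
Qed.

End BoundaryConditionsAsFrozenSpins.

(** * The field-dependent constant attached to a starting site *)

Section PathConstant.
Variables (R : realType) (d : nat) (delta kappa : R).
Hypothesis kappa01 : 0 < kappa <= 1.

(** [xget] makes the threshold a function of [x] and [h] for every field; the default 0 serves
    fields without any threshold. *)
Definition path_threshold (x : site d) (h : site d -> R) : nat :=
  xget 0%N [set N | decays_from delta kappa h x N].

Definition path_constant x h : R := kappa^-1 ^+ path_threshold x h.

Lemma path_constant_ge1 x h : 1 <= path_constant x h.
Proof.
by case/andP: kappa01 => k0 k1; rewrite exprn_ege1 // invf_ge1.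
Qed.

Lemma pin_weight_ge0 (a : R) : 0 <= pin_weight delta kappa a.
Proof.
by rewrite /pin_weight; case: ifP => // _; rewrite exprn_ge0 // ltW //; case/andP: kappa01.
Qed.

(** A path shorter than the threshold has weight at most 1, and there [path_constant] outweighs
    [kappa ^+ (size p).+1]. *)
Lemma prod_pin_weight_le x h p : (exists N, decays_from delta kappa h x N) ->
  path (@adj d) x p -> uniq (x :: p) ->
  \prod_(u <- x :: p) pin_weight delta kappa (h u)
    <= path_constant x h * kappa ^+ (size p).+1.
Proof.
case/andP: (kappa01) => k0 k1 [N hN] xp up.
have dec : decays_from delta kappa h x (path_threshold x h) by exact: (xgetI 0%N hN).
have [np|pn] := leqP (path_threshold x h) (size p).
  apply: le_trans (dec p xp up np) _; rewrite ler_peMl ?path_constant_ge1 //.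
  by rewrite exprn_ge0 // ltW.
apply: (@le_trans _ _ 1).
  apply: prodr_ile1 => u _; rewrite pin_weight_ge0 /pin_weight.
  by case: ifP => _ /=; [exact: lexx | apply: exprn_ile1 => //; exact: ltW].
rewrite /path_constant exprVn mulrC ler_pdivlMr ?exprn_gt0 // mul1r.
by apply: ler_wiXn2l; rewrite ?(ltW k0).
Qed.

End PathConstant.

(** * Choice of the constants *)

Theorem theorem6 (R : realType) (d : nat) (d_ge1 : (1 <= d)%N) :
  exists (C5 : R) (C6 : site d -> (site d -> R) -> R),
    0 < C5 /\ (forall x h, 0 < C6 x h) /\
    forall beta : R, 0 <= beta ->
    exists H3 : R, 0 < H3 /\
    forall H : R, H3 < H ->
    forall (disp : measure_display) (Omega : measurableType disp)
      (P : probability Omega R) (X : site d -> {RV P >-> R}),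
    iid_std_normal X ->
    {ae P, forall w : Omega,
      let h : site d -> R := fun u => X u w in
      forall (D L : {fset site d}) (DL : (D `<=` L)%fset),
        \big[Num.max/0]_(e : config (ext_boundary L) * config (ext_boundary L))
           TV (gibbs_marginal e.1 beta H h DL) (gibbs_marginal e.2 beta H h DL)
        <= \sum_(x <- ext_boundary D) \sum_(y <- ext_boundary L)
             C6 x h * expR (- C5 * euclid_norm R (x - y))}.
Proof.
(* Chosen so that [2 * (2 * d) * k = 1], the condition for the geometric series over paths in a
   graph of degree at most [2 * d]. *)
pose k : R := (4 * d)%:R^-1.
have k0 : 0 < k by rewrite invr_gt0 ltr0n muln_gt0.
have k1 : k <= 1 by rewrite invf_le1 ?ler1n ?ltr0n muln_gt0.
pose kappa : R := expR (- 1) * k.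
have kappa0 : 0 < kappa by rewrite mulr_gt0 ?expR_gt0.
have kappa1 : kappa <= 1.
  by rewrite mulr_ile1 ?expR_ge0 ?(ltW k0) // -expR0 ler_expR lerN10.
have kappa01 : 0 < kappa <= 1 by rewrite kappa0.
(* This bound on the probability of a weak site is the one that Borel-Cantelli asks for; [delta] is
   fixed before [beta] and [H]. *)
have [|delta delta0 small] := @normal_prob_small_ball R ((8 * d)%:R^-1 ^+ 2).
  by rewrite exprn_gt0 // invr_gt0 ltr0n muln_gt0.
exists 1, (fun x h => 2 * path_constant delta kappa x h).
split; first exact: ltr01.
split; first by move=> x h; rewrite mulr_gt0 // (lt_le_trans ltr01) ?path_constant_ge1.
move=> beta beta0.
(* Solves [2 * (2 * d) * beta - 2 * H * delta <= ln (kappa ^+ 2)] for [H], so that sites with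
   [|h x| >= delta] are pinned with weight [kappa ^+ 2]; the added 1 ensures positivity. *)
pose H3 : R := (2 * ((2 * d)%:R * beta) - ln (kappa ^+ 2)) / (2 * delta) + 1.
have H30 : 0 < H3.
  apply: ltr_wpDl => //; apply: divr_ge0; last by rewrite mulr_ge0 // ltW.
  rewrite subr_ge0 (@le_trans _ _ 0) //.
    by rewrite ln_le0 // exprn_ile1 // ltW.
  by rewrite !mulr_ge0.
exists H3; split => // H HH3 disp Omega P X iid.
apply: filterS (ae_decays_from d_ge1 kappa01 iid small) => w dec D L DL.
set h := fun u : site d => X u w.
(* Both maxima start from 0, so the bound must itself be nonnegative. *)
have rhs0 : 0 <= \sum_(x <- ext_boundary D) \sum_(y <- ext_boundary L)
    2 * path_constant delta kappa x h * expR (- 1 * euclid_norm R (x - y)).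
  apply: sumr_ge0 => x _; apply: sumr_ge0 => y _; rewrite mulr_ge0 ?expR_ge0 //.
  by rewrite mulr_ge0 // (le_trans ler01) ?path_constant_ge1.
apply: bigmax_le => // -[e1 e2] _; apply: bigmax_le => // A _ /=.
apply: (@marginal_dist R d L beta H h (fun x => pin_weight delta kappa (h x))
  (fun x => path_constant delta kappa x h) k) => //.
- exact: ltW.
- by rewrite -natrM mulnA divff // pnatr_eq0 muln_eq0 negb_or -!lt0n.
- by move=> x; exact: pin_weight_ge0.
- by move=> x; exact: path_constant_ge1.
- move=> x; rewrite /pin_weight; case: ltP => [_|hx]; [by left|right].
  rewrite -[leRHS]lnK ?posrE ?exprn_gt0 // ler_expR lerBlDl -lerBlDr.
  rewrite normrM (gtr0_norm (lt_trans H30 HH3)).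
  apply: (@le_trans _ _ (H3 * (2 * delta))).
    by rewrite /H3 [leRHS]mulrDl divfK ?gt_eqF ?mulr_gt0 // lerDl mul1r ltW // mulr_gt0.
  rewrite [leRHS]mulrCA; apply: ler_pM; rewrite ?(ltW H30) ?(ltW HH3) ?mulr_ge0 ?(ltW delta0) //.
  by rewrite ler_pM2l.
- by move=> x p xp up; apply: prod_pin_weight_le.
Qed.
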